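(* Let $s=1$. The coefficients $(\alpha,\beta^{(1)},\beta^{(2)},\beta^{(3)},\beta^{(4)},A^{(0)},A^{(1)},A^{(2)},B^{(0)},B^{(1)},B^{(2)})$ of an explicit $1$-stage stochastic Runge-Kutta (SRK) method satisfy the order one conditions 1.--9. listed in the context if and only if there is $c_1\in\{-1,1\}$ such that $$\alpha_1=1,\qquad \beta^{(1)}_1=c_1,\qquad \beta^{(2)}_1=0,\qquad \beta^{(3)}_1=0,\qquad \beta^{(4)}_1=0 .$$ The resulting class of schemes coincides with the (weak) Euler-Maruyama scheme, i.e. the recursion becomes $Y_{n+1}=Y_n+a(t_n,Y_n)\,h_n+c_1\sum_{k=1}^m b^k(t_n,Y_n)\,\hat I_{(k)}$.
   Context: Consider the $d$-dimensional It\^o SDE $dX(t)=a(t,X(t))\,dt+b(t,X(t))\,dW(t)$, $X(t_0)=x_0$, with an $m$-dimensional Wiener process $W$; $b^k$ denotes the $k$-th column of $b$. Let $t_0<t_1<\dots<t_N$ be a time grid with step sizes $h_n=t_{n+1}-t_n$. An explicit $s$-stage SRK method has coefficients $\alpha,\beta^{(1)},\dots,\beta^{(4)}\in\mathbb{R}^s$ and $A^{(q)},B^{(q)}\in\mathbb{R}^{s\times s}$, $q=0,1,2$, where $A^{(q)}_{ij}=B^{(q)}_{ij}=0$ for $j\ge i$ and $q\in\{0,1\}$ (no restriction is imposed on $A^{(2)},B^{(2)}$), and $c^{(q)}=A^{(q)}e$ with $e=(1,\dots,1)^T$. It is given by $Y_0=x_0$ and $$Y_{n+1}=Y_n+\sum_{i=1}^s\alpha_i\,a(t_n+c^{(0)}_ih_n,H^{(0)}_i)h_n+\sum_{i=1}^s\sum_{k=1}^m\Big(\beta^{(1)}_i\hat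 I_{(k)}+\beta^{(2)}_i\tfrac{\hat I_{(k,k)}}{\sqrt{h_n}}\Big)b^k(t_n+c^{(1)}_ih_n,H^{(k)}_i)$$ $$+\sum_{i=1}^s\sum_{k=1}^m\big(\beta^{(3)}_i\hat I_{(k)}+\beta^{(4)}_i\sqrt{h_n}\big)b^k(t_n+c^{(2)}_ih_n,\hat H^{(k)}_i),$$ with stages $$H^{(0)}_i=Y_n+\sum_{j=1}^{i-1}A^{(0)}_{ij}a(t_n+c^{(0)}_jh_n,H^{(0)}_j)h_n+\sum_{j=1}^{i-1}\sum_{l=1}^mB^{(0)}_{ij}b^l(t_n+c^{(1)}_jh_n,H^{(l)}_j)\hat I_{(l)},$$ $$H^{(k)}_i=Y_n+\sum_{j=1}^{i-1}A^{(1)}_{ij}a(t_n+c^{(0)}_jh_n,H^{(0)}_j)h_n+\sum_{j=1}^{i-1}B^{(1)}_{ij}b^k(t_n+c^{(1)}_jh_n,H^{(k)}_j)\sqrt{h_n},$$ $$\hat H^{(k)}_i=Y_n+\sum_{j=1}^{s}A^{(2)}_{ij}a(t_n+c^{(0)}_jh_n,H^{(0)}_j)h_n+\sum_{j=1}^{s}\sum_{l\ne k}B^{(2)}_{ij}b^l(t_n+c^{(1)}_jh_n,H^{(l)}_j)\tfrac{\hat I_{(k,l)}}{\sqrt{h_n}}.$$ Here $\hat I_{(k)}$ are three-point random variables with $P(\hat I_{(k)}=\pm\sqrt{3h_n})=\frac16$, $P(\hat I_{(k)}=0)=\frac23$; $\hat I_{(k,l)}=\frac12(\hat I_{(k)}\hat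 I_{(l)}-\sqrt{h_n}\tilde I_{(k)})$ if $k<l$, $\frac12(\hat I_{(k)}\hat I_{(l)}+\sqrt{h_n}\tilde I_{(l)})$ if $l<k$, $\frac12(\hat I_{(k)}^2-h_n)$ if $k=l$, with $P(\tilde I_{(k)}=\pm\sqrt{h_n})=\frac12$. Order one conditions (powers and products of vectors are component-wise): 1. $\alpha^Te=1$; 2. ${\beta^{(4)}}^Te=0$; 3. ${\beta^{(3)}}^Te=0$; 4. $({\beta^{(1)}}^Te)^2=1$; 5. ${\beta^{(2)}}^Te=0$; 6. ${\beta^{(1)}}^TB^{(1)}e=0$; 7. ${\beta^{(4)}}^TA^{(2)}e=0$; 8. ${\beta^{(3)}}^TB^{(2)}e=0$; 9. ${\beta^{(4)}}^T(B^{(2)}e)^2=0$. *)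

(* Defs.v *)
From HB Require Import structures.
From mathcomp Require Import all_boot all_order all_algebra.
From mathcomp Require Import all_classical all_reals all_analysis.

Set Implicit Arguments.
Unset Strict Implicit.
Unset Printing Implicit Defensive.

Import Order.TTheory GRing.Theory Num.Theory.

Local Open Scope classical_set_scope.
Local Open Scope ring_scope.

(* Indices start at 0: stage i and noise component k of the literature are
   the ordinals i - 1 : 'I_s and k - 1 : 'I_m. *)

Record srk_coeffs (R : realType) (s : nat) := SrkCoeffs {
  alpha : 'cV[R]_s;
  beta1 : 'cV[R]_s;
  beta2 : 'cV[R]_s;
  beta3 : 'cV[R]_s;
  beta4 : 'cV[R]_s;
  A0 : 'M[R]_s;
  A1 : 'M[R]_s;
  A2 : 'M[R]_s;
  B0 : 'M[R]_s;
  B1 : 'M[R]_s;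
  B2 : 'M[R]_s
}.

Section Coefficients.
Context (R : realType) (s : nat).
Implicit Types (C : srk_coeffs R s) (u v : 'cV[R]_s).

Definition onev : 'cV[R]_s := const_mx 1.
Definition dotv u v : R := (u^T *m v) ord0 ord0.
Definition sqv u : 'cV[R]_s := map_mx (fun x => x ^+ 2) u.

Definition node0 C : 'cV[R]_s := A0 C *m onev.
Definition node1 C : 'cV[R]_s := A1 C *m onev.
Definition node2 C : 'cV[R]_s := A2 C *m onev.

(* A2 and B2 are unrestricted: the stages they define do not enter the
   other stages. *)
Definition srk_explicit C : Prop :=
  forall i j : 'I_s, (i <= j)%N ->
    [/\ A0 C i j = 0, A1 C i j = 0, B0 C i j = 0 & B1 C i j = 0].

Definition order_one C : Prop :=
  (dotv (alpha C) onev = 1) /\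
  (dotv (beta4 C) onev = 0) /\
  (dotv (beta3 C) onev = 0) /\
  (dotv (beta1 C) onev ^+ 2 = 1) /\
  (dotv (beta2 C) onev = 0) /\
  (dotv (beta1 C) (B1 C *m onev) = 0) /\
  (dotv (beta4 C) (A2 C *m onev) = 0) /\
  (dotv (beta3 C) (B2 C *m onev) = 0) /\
  (dotv (beta4 C) (sqv (B2 C *m onev)) = 0).

End Coefficients.

(* xi k and eta k are the values of hat I_(k) and tilde I_(k). *)
Definition hatI2 (R : realType) (m : nat) (h : R) (xi eta : 'I_m -> R)
    (k l : 'I_m) : R :=
  if (k < l)%N then (xi k * xi l - Num.sqrt h * eta k) / 2
  else if (l < k)%N then (xi k * xi l + Num.sqrt h * eta l) / 2
  else (xi k ^+ 2 - h) / 2.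

Section Step.
Context (R : realType) (s d m : nat) (C : srk_coeffs R s).
Context (a : R -> 'cV[R]_d -> 'cV[R]_d) (b : R -> 'cV[R]_d -> 'M[R]_(d, m)).
Context (tn h : R) (xi eta : 'I_m -> R) (y : 'cV[R]_d).
Context (H0 : 'I_s -> 'cV[R]_d) (H Hh : 'I_m -> 'I_s -> 'cV[R]_d).

Let a_at j := a (tn + node0 C j ord0 * h) (H0 j).
Let b_at k j := col k (b (tn + node1 C j ord0 * h) (H k j)).
Let bh_at k j := col k (b (tn + node2 C j ord0 * h) (Hh k j)).

Definition srk_stage0 : Prop := forall i,
  H0 i = y
    + \sum_(j < s | (j < i)%N) (A0 C i j * h) *: a_at j
    + \sum_(j < s | (j < i)%N) \sum_(l < m) (B0 C i j * xi l) *: b_at l j.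

Definition srk_stage1 : Prop := forall k i,
  H k i = y
    + \sum_(j < s | (j < i)%N) (A1 C i j * h) *: a_at j
    + \sum_(j < s | (j < i)%N) (B1 C i j * Num.sqrt h) *: b_at k j.

Definition srk_stage2 : Prop := forall k i,
  Hh k i = y
    + \sum_(j < s) (A2 C i j * h) *: a_at j
    + \sum_(j < s) \sum_(l < m | l != k)
        (B2 C i j * (hatI2 h xi eta k l / Num.sqrt h)) *: b_at l j.

Definition srk_update : 'cV[R]_d :=
  y + \sum_(i < s) (alpha C i ord0 * h) *: a_at i
    + \sum_(i < s) \sum_(k < m)
        (beta1 C i ord0 * xi k
           + beta2 C i ord0 * (hatI2 h xi eta k k / Num.sqrt h)) *: b_at k i
    + \sum_(i < s) \sum_(k < m)
        (beta3 C i ord0 * xi k + beta4 C i ord0 * Num.sqrt h) *: bh_at k i.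

End Step.

Definition srk_step (R : realType) (s d m : nat) (C : srk_coeffs R s)
    (a : R -> 'cV[R]_d -> 'cV[R]_d) (b : R -> 'cV[R]_d -> 'M[R]_(d, m))
    (tn h : R) (xi eta : 'I_m -> R) (y y' : 'cV[R]_d) : Prop :=
  exists (H0 : 'I_s -> 'cV[R]_d) (H Hh : 'I_m -> 'I_s -> 'cV[R]_d),
    [/\ srk_stage0 C a b tn h xi y H0 H,
        srk_stage1 C a b tn h y H0 H,
        srk_stage2 C a b tn h xi eta y H0 H Hh
      & y' = srk_update C a b tn h xi eta y H0 H Hh].

Definition time_grid (R : realType) (N : nat) (t : nat -> R) : Prop :=
  forall n, (n < N)%N -> t n < t n.+1.

Definition step_size (R : realType) (t : nat -> R) (n : nat) : R :=
  t n.+1 - t n.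

Section Schemes.
Context (R : realType) (disp : measure_display) (T : measurableType disp).
Context (P : probability T R) (d m : nat).

Definition three_point_law (h : R) (X : {RV P >-> R}) : Prop :=
  [/\ P [set w | X w = Num.sqrt (3 * h)] = (6^-1)%:E,
      P [set w | X w = - Num.sqrt (3 * h)] = (6^-1)%:E
    & P [set w | X w = 0] = (2 / 3)%:E].

Definition two_point_law (h : R) (X : {RV P >-> R}) : Prop :=
  P [set w | X w = Num.sqrt h] = (2^-1)%:E /\
  P [set w | X w = - Num.sqrt h] = (2^-1)%:E.

(* hI n k and tI n k are hat I_(k) and tilde I_(k) on the n-th step. *)
Definition srk_noise (N : nat) (t : nat -> R)
    (hI tI : nat -> 'I_m -> {RV P >-> R}) : Prop :=
  forall n, (n < N)%N -> forall k,
    three_point_law (step_size t n) (hI n k) /\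
    two_point_law (step_size t n) (tI n k).

Context (a : R -> 'cV[R]_d -> 'cV[R]_d) (b : R -> 'cV[R]_d -> 'M[R]_(d, m)).
Context (x0 : T -> 'cV[R]_d) (N : nat) (t : nat -> R).

Definition srk_approx (s : nat) (C : srk_coeffs R s)
    (hI tI : nat -> 'I_m -> {RV P >-> R}) (Y : nat -> T -> 'cV[R]_d) : Prop :=
  forall w, Y 0%N w = x0 w /\
    forall n, (n < N)%N ->
      srk_step C a b (t n) (step_size t n) (hI n ^~ w) (tI n ^~ w)
        (Y n w) (Y n.+1 w).

Definition euler_maruyama (c : R) (hI : nat -> 'I_m -> {RV P >-> R})
    (Y : nat -> T -> 'cV[R]_d) : Prop :=
  forall w, Y 0%N w = x0 w /\
    forall n, (n < N)%N ->
      Y n.+1 w = Y n w + step_size t n *: a (t n) (Y n w)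
        + c *: \sum_(k < m) hI n k w *: col k (b (t n) (Y n w)).

End Schemes.

Definition euler_coeffs (R : realType) (C : srk_coeffs R 1) (c : R) : Prop :=
  [/\ alpha C ord0 ord0 = 1, beta1 C ord0 ord0 = c, beta2 C ord0 ord0 = 0,
      beta3 C ord0 ord0 = 0 & beta4 C ord0 ord0 = 0].

(* Main.v *)
Require Import Defs.
From HB Require Import structures.
From mathcomp Require Import all_boot all_order all_algebra.
From mathcomp Require Import all_classical all_reals all_analysis.

Import Order.TTheory GRing.Theory Num.Theory.
Local Open Scope classical_set_scope.
Local Open Scope ring_scope.

(* With one stage explicitness leaves nothing to choose: the stages H^(0) and
   H^(k) are Y_n and the nodes c^(0), c^(1) vanish, while conditions 2, 3 and 5
   kill beta4, beta3 and beta2.  The supporting stages, whose coefficients A2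
   and B2 stay free, therefore never enter the update, and the condition
   beta1^2 = 1 leaves only the sign of the noise. *)

Lemma dotv_scalar (R : realType) (u v : 'cV[R]_1) :
  dotv u v = u ord0 ord0 * v ord0 ord0.
Proof. by rewrite /dotv mxE big_ord1 mxE. Qed.

(** Conditions 7 to 9 carry a factor [beta3] or [beta4], hence vanish. Condition 6 has the nonzero
    factor [c], so there explicitness must supply [B1 = 0]. *)
Lemma order_one_of_euler_coeffs (R : realType) (C : srk_coeffs R 1) (c : R) :
  srk_explicit C -> c = -1 \/ c = 1 -> euler_coeffs C c -> order_one C.
Proof.
move=> exC hc [ha h1 h2 h3 h4].
have [_ _ _ hB1] := exC ord0 ord0 (leqnn _).
have c2 : c ^+ 2 = 1 by case: hc => ->; rewrite ?sqrrN expr1n.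
rewrite /order_one !dotv_scalar ha h1 h2 h3 h4 !mul0r.
by rewrite !mxE big_ord1 hB1 mul0r mulr0 !mulr1.
Qed.

Lemma euler_coeffs_of_order_one (R : realType) (C : srk_coeffs R 1) :
  order_one C -> exists c : R, (c = -1 \/ c = 1) /\ euler_coeffs C c.
Proof.
(* Fixing the key expands only the constant vector [onev]; the matrix products of conditions 6 to 9
   stay folded. *)
rewrite /order_one !dotv_scalar !(mxE const_mx_key) !mulr1.
move=> [ha [h4 [h3 [h1 [h2 _]]]]].
exists (beta1 C ord0 ord0); split=> //.
by move/eqP: h1; rewrite sqrf_eq1 => /orP[] /eqP; [right | left].
Qed.

(** The only entry of [A0] and [A1] is diagonal. This is what places [a] and [b] at time [tn] in the
    update. *)
Lemma explicit_nodes0 (R : realType) (C : srk_coeffs R 1) :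
  srk_explicit C -> node0 C ord0 ord0 = 0 /\ node1 C ord0 ord0 = 0.
Proof.
move=> exC; have [hA0 hA1 _ _] := exC ord0 ord0 (leqnn _).
by rewrite /node0 /node1 !mxE !big_ord1 hA0 hA1 !mul0r.
Qed.

Lemma sum_below_ord1 (V : nmodType) (i : 'I_1) (F : 'I_1 -> V) :
  \sum_(j < 1 | (j < i)%N) F j = 0.
Proof. by rewrite big_pred0 // => j; rewrite !ord1. Qed.

Section OneStage.
Context (R : realType) (d m : nat) (C : srk_coeffs R 1) (c : R).
Context (a : R -> 'cV[R]_d -> 'cV[R]_d) (b : R -> 'cV[R]_d -> 'M[R]_(d, m)).
Context (tn h : R) (xi eta : 'I_m -> R) (y : 'cV[R]_d).

Lemma one_stage_srk_stage0 H0 H :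
  srk_stage0 C a b tn h xi y H0 H <-> forall i, H0 i = y.
Proof.
rewrite /srk_stage0 /=.
by split=> H0E i; move: (H0E i); rewrite !sum_below_ord1 !addr0.
Qed.

Lemma one_stage_srk_stage1 H0 H :
  srk_stage1 C a b tn h y H0 H <-> forall k i, H k i = y.
Proof.
rewrite /srk_stage1 /=.
by split=> HE k i; move: (HE k i); rewrite !sum_below_ord1 !addr0.
Qed.

Lemma one_stage_srk_update H0 H Hh :
    srk_explicit C -> euler_coeffs C c ->
    (forall i, H0 i = y) -> (forall k i, H k i = y) ->
  srk_update C a b tn h xi eta y H0 H Hh =
  y + h *: a tn y + c *: \sum_(k < m) xi k *: col k (b tn y).
Proof.
move=> exC [ha h1 h2 h3 h4] H0E HE; have [n0 n1] := explicit_nodes0 _ _ exC.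
rewrite /srk_update !big_ord1 ha h1 h2 h3 h4 H0E n0 n1 !mul0r !addr0 mul1r.
(* The last sum runs over the supporting stages; its weights are now zero, so it vanishes for
   arbitrary [Hh]. *)
rewrite [X in _ + X]big1 => [|k _]; last by rewrite mul0r addr0 scale0r.
rewrite addr0 scaler_sumr; congr (_ + _); apply: eq_bigr => k _.
by rewrite HE mul0r addr0 scalerA.
Qed.

Lemma one_stage_srk_stepE y' : srk_explicit C -> euler_coeffs C c ->
  srk_step C a b tn h xi eta y y' <->
  y' = y + h *: a tn y + c *: \sum_(k < m) xi k *: col k (b tn y).
Proof.
move=> exC eC; split.
  move=> [H0 [H [Hh [/one_stage_srk_stage0 H0E /one_stage_srk_stage1 HE _ ->]]]].
  exact: one_stage_srk_update.
move=> ->; exists (fun=> y), (fun _ _ => y).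
(* The equation for [Hh] is explicit in [H0] and [H], so [Hh] may stay open here; the closing
   [reflexivity] takes its right-hand side as the witness. *)
eexists; split; last by rewrite one_stage_srk_update.
- exact/one_stage_srk_stage0.
- exact/one_stage_srk_stage1.
- by move=> k i; reflexivity.
Qed.

End OneStage.

Theorem mainTheorem1 (R : realType) :
  (forall C : srk_coeffs R 1, srk_explicit C ->
     (order_one C <->
      exists c : R, (c = -1 \/ c = 1) /\ euler_coeffs C c)) /\
  (forall (C : srk_coeffs R 1) (c : R),
     srk_explicit C -> order_one C -> euler_coeffs C c ->
     forall (disp : measure_display) (T : measurableType disp)
       (P : probability T R) (d m : nat)
       (a : R -> 'cV[R]_d -> 'cV[R]_d) (b : R -> 'cV[R]_d -> 'M[R]_(d, m))
       (x0 : T -> 'cV[R]_d) (N : nat) (t : nat -> R)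
       (hI tI : nat -> 'I_m -> {RV P >-> R}),
     time_grid N t -> srk_noise N t hI tI ->
     forall Y : nat -> T -> 'cV[R]_d,
       srk_approx a b x0 N t C hI tI Y <->
       euler_maruyama a b x0 N t c hI Y) /\
  (forall c : R, c = -1 \/ c = 1 ->
     exists C : srk_coeffs R 1,
       [/\ srk_explicit C, order_one C & euler_coeffs C c]).
Proof.
split=> [C exC|]; last split.
- split=> [|[c [hc eC]]]; first exact: euler_coeffs_of_order_one.
  exact: (order_one_of_euler_coeffs _ _ c).
- move=> C c exC _ eC disp T P d m a b x0 N t hI tI _ _ Y.
  (* The equivalence is pathwise: it holds for each outcome [w] and each step [n] separately. *)
  by split=> YP w; have [Y0 YS] := YP w; split=> // n /YS;
    rewrite (one_stage_srk_stepE _ _ _ _ c).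
- move=> c hc.
  (* Both signs occur: the weights are the forced ones, and zero matrices make the method
     explicit. *)
  pose C := @SrkCoeffs R 1 (const_mx 1) (const_mx c) 0 0 0 0 0 0 0 0 0.
  have exC : srk_explicit C by move=> i j _; rewrite !mxE.
  have eC : euler_coeffs C c by split; rewrite mxE.
  by exists C; split=> //; exact: (order_one_of_euler_coeffs _ _ c).
Qed.
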